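(* Let $\alpha\in(0,2)$, $d\in\mathbb{N}$ and assume that $d<2\alpha$. (1) If $d>\alpha$, then $\mathcal{R}_{d,\alpha}\subset\overline{\mathcal{R}}_{d,\alpha}$. In particular, there exists a constant $C_{d,\alpha}>0$ such that $[V]_{\overline{\mathcal{R}}_{d,\alpha}}\le C_{d,\alpha}\|V\|_{\mathcal{R}_{d,\alpha}}$ for every $V\in\mathcal{R}_{d,\alpha}$. (2) For every $m>0$ we have $\overline{\mathcal{R}}_{d,\alpha}\subset\overline{\mathcal{R}}^m_{d,\alpha}$. In particular, there exists a constant $C_{d,\alpha}>0$ such that $[V]_{\overline{\mathcal{R}}^m_{d,\alpha}}\le C_{d,\alpha}[V]_{\overline{\mathcal{R}}_{d,\alpha}}$ for every $V\in\overline{\mathcal{R}}_{d,\alpha}$.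
   Context: For $\alpha<d<2\alpha$, $\mathcal{R}_{d,\alpha}$ is the set of measurable $V:\mathbb{R}^d\to\mathbb{R}$ with $\|V\|^2_{\mathcal{R}_{d,\alpha}}=\int_{\mathbb{R}^d}\int_{\mathbb{R}^d}\frac{|V(x)||V(y)|}{|x-y|^{2(d-\alpha)}}dx\,dy<\infty$. For $d<2\alpha$ and $m\ge0$, the extended fractional Rollnik-class $\overline{\mathcal{R}}^m_{d,\alpha}$ is the set of measurable $V:\mathbb{R}^d\to\mathbb{R}$ with $$[V]^2_{\overline{\mathcal{R}}^m_{d,\alpha}}=\int_{\mathbb{R}^d}\int_{\mathbb{R}^d}H^m_{d,\alpha}(|x-y|)^2|V(x)||V(y)|\,dx\,dy<\infty ,$$ and the superscript is omitted if $m=0$. Here, for $r>0$, put $h(r)=r^{-(d-\alpha)}$ if $\alpha<d$, $h(r)=\log(1+\frac1r)$ if $\alpha=d=1$, $h(r)=1$ if $\alpha>d=1$. Then $$H^0_{d,\alpha}(r)=h(r)\mathbf{1}_{\{r\le1\}}+2^{\frac{d+\alpha}{2}-1}\Gamma\big(\tfrac{d+\alpha}{2}\big)r^{-(d+\alpha)}\mathbf{1}_{\{r>1\}},$$ $$H^m_{d,\alpha}(r)=h(r)\mathbf{1}_{\{r\le1\}}+r^{-\frac{d+\alpha}{2}}\kappa_m(r)\mathbf{1}_{\{r>1\}}\quad(m>0),$$ where $\kappa_m(r)=m^{(d+\alpha)/(2\alpha)}K_{(d+\alpha)/2}(m^{1/\alpha}r)$ and $K_\rho(z)=\frac12(\frac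 z2)^\rho\int_0^\infty t^{-\rho-1}e^{-t-\frac{z^2}{4t}}dt$ is the modified Bessel function of the second kind. *)

(* Defs.v *)
From HB Require Import structures.
From mathcomp Require Import all_boot all_order all_algebra.
From mathcomp Require Import all_classical all_reals all_analysis.

Set Implicit Arguments.
Unset Strict Implicit.
Unset Printing Implicit Defensive.

Import Order.TTheory GRing.Theory Num.Theory.
Import numFieldNormedType.Exports.

Local Open Scope classical_set_scope.
Local Open Scope ring_scope.

(* Points of R^d are tuples rather than row vectors because MathComp-Analysis
   equips tuples with the product sigma-algebra, here the Borel sets of R^d. *)
Notation Rn R d := (d.-tuple (measurableTypeR R)).

Section lebesgue_Rn_step.
Context (R : realType) (d : nat).
Variable mu : {sigma_finite_measure set (Rn R d) -> \bar R}.

Definition Rn_cons (p : measurableTypeR R * Rn R d) : Rn R d.+1 :=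
  [tuple of p.1 :: p.2].

Lemma measurable_Rn_cons : measurable_fun setT Rn_cons.
Proof. exact: measurable_cons. Qed.

Definition lebesgue_Rn_step : set (Rn R d.+1) -> \bar R :=
  pushforward (@lebesgue_measure R \x mu)%E Rn_cons.

Let lebesgue_Rn_step0 : lebesgue_Rn_step set0 = 0%E.
Proof. by rewrite /lebesgue_Rn_step /pushforward preimage_set0 measure0. Qed.

Let lebesgue_Rn_step_ge0 A : (0 <= lebesgue_Rn_step A)%E.
Proof. by rewrite /lebesgue_Rn_step /pushforward measure_ge0. Qed.

Let lebesgue_Rn_step_sigma_additive : semi_sigma_additive lebesgue_Rn_step.
Proof.
move=> F mF tF mUF; rewrite /lebesgue_Rn_step /pushforward preimage_bigcup.
apply: measure_semi_sigma_additive.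
- by move=> n; rewrite -[X in measurable X]setTI; exact: measurable_Rn_cons.
- apply/trivIsetP => /= i j _ _ ij; rewrite -preimage_setI.
  by move/trivIsetP : tF => /(_ _ _ _ _ ij) ->//; rewrite preimage_set0.
- rewrite -preimage_bigcup -[X in measurable X]setTI.
  exact: measurable_Rn_cons.
Qed.

HB.instance Definition _ := isMeasure.Build _ _ _ lebesgue_Rn_step
  lebesgue_Rn_step0 lebesgue_Rn_step_ge0 lebesgue_Rn_step_sigma_additive.

Let lebesgue_Rn_step_sigma_finite : sigma_finite setT lebesgue_Rn_step.
Proof.
have /sigma_finiteP[F [TF ndF Foo]] := sigma_finiteT (@lebesgue_measure R).
have /sigma_finiteP[G [TG ndG Goo]] := sigma_finiteT mu.
pose g (t : Rn R d.+1) : measurableTypeR R * Rn R d :=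
  (thead t, [tuple of behead t]).
have mg : measurable_fun setT g.
  apply/measurable_fun_pair; last exact: measurable_behead.
  exact: measurable_tnth.
have gK : cancel Rn_cons g.
  by move=> [x t]; congr pair; apply: val_inj.
exists (fun n => g @^-1` (F n `*` G n)).
  apply/seteqP; split=> // t _.
  have [n _ Fn] : (\bigcup_n F n) (g t).1 by rewrite -TF.
  have [k _ Gk] : (\bigcup_n G n) (g t).2 by rewrite -TG.
  exists (maxn n k) => //; split.
  - by move: Fn; exact/subsetPset/ndF/leq_maxl.
  - by move: Gk; exact/subsetPset/ndG/leq_maxr.
move=> n; have [? ?] := Foo n; have [? ?] := Goo n; split.
  by rewrite -[X in measurable X]setTI; apply: mg => //; exact: measurableX.
rewrite /lebesgue_Rn_step /pushforward -comp_preimage.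
rewrite (_ : g \o Rn_cons = id); last exact/funext.
by rewrite preimage_id product_measure1E// lte_mul_pinfty// ge0_fin_numE.
Qed.

HB.instance Definition _ := Measure_isSigmaFinite.Build _ _ _
  lebesgue_Rn_step lebesgue_Rn_step_sigma_finite.

End lebesgue_Rn_step.

Section lebesgue_Rn0.
Context (R : realType).

Definition lebesgue_Rn0 : set (Rn R 0) -> \bar R := \d_[tuple].

HB.instance Definition _ := Measure.on lebesgue_Rn0.

Let lebesgue_Rn0_sigma_finite : sigma_finite setT lebesgue_Rn0.
Proof.
apply: fin_num_fun_sigma_finite; first by rewrite measure0.
by move=> A mA; rewrite /lebesgue_Rn0 diracE.
Qed.

HB.instance Definition _ := Measure_isSigmaFinite.Build _ _ _
  lebesgue_Rn0 lebesgue_Rn0_sigma_finite.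

End lebesgue_Rn0.

(* Lebesgue measure on R^d, as the d-fold product of lebesgue_measure; the lemma
   lebesgue_Rn_box below gives its values on the boxes, which determine it. *)
Fixpoint lebesgue_Rn (R : realType) (d : nat) :
    {sigma_finite_measure set (Rn R d) -> \bar R} :=
  match d with
  | 0%N => @lebesgue_Rn0 R
  | d'.+1 => lebesgue_Rn_step (lebesgue_Rn R d')
  end.

Lemma lebesgue_Rn_box (R : realType) (d : nat)
    (A : 'I_d -> set (measurableTypeR R)) :
  (forall i, measurable (A i)) ->
  lebesgue_Rn R d [set x | forall i, A i (tnth x i)] =
  (\prod_(i < d) @lebesgue_measure R (A i))%E.
Proof.
elim: d A => [|d IHd] A mA.
  rewrite big_ord0 /= /lebesgue_Rn0 diracE mem_set//.
  by case.
rewrite big_ord_recl -IHd//= /lebesgue_Rn_step /pushforward.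
rewrite (_ : _ @^-1` _ =
  A ord0 `*` [set x | forall i, A (lift ord0 i) (tnth x i)]); last first.
  apply/seteqP; split=> [[x t]/= Axt|[x t]/= [A0 At] i].
    by split=> [|i]; [have := Axt ord0|have := Axt (lift ord0 i); rewrite tnthS].
  by case: (unliftP ord0 i) => [j|] ->; rewrite ?tnthS.
rewrite product_measure1E//.
rewrite (_ : mkset _ =
  \bigcap_(i in setT) [set x | A (lift ord0 i) (tnth x i)]); last first.
  by apply/seteqP; split=> [x/= Ax i _ //|x/= Ax i]; exact: Ax.
apply: fin_bigcap_measurable => // i _; rewrite -[X in measurable X]setTI.
by apply: (@measurable_tnth _ (measurableTypeR R) d i) => //; exact: mA.
Qed.

(* The norm `|_| on MathComp vectors is the sup norm, hence this definition. *)
Definition euclidean_dist (R : realType) (d : nat) (x y : Rn R d) : R :=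
  Num.sqrt (\sum_(i < d) (tnth x i - tnth y i : R) ^+ 2).

Definition Gamma (R : realType) (s : R) : R :=
  \int[@lebesgue_measure R]_(t in `]0, +oo[) (t `^ (s - 1) * expR (- t)).

Definition besselK (R : realType) (rho z : R) : R :=
  2^-1 * (z / 2) `^ rho *
  \int[@lebesgue_measure R]_(t in `]0, +oo[)
    (t `^ (- rho - 1) * expR (- t - z ^+ 2 / (4 * t))).

Section rollnik.
Context (R : realType) (d : nat) (alpha : R).

(* The last branch is reached for alpha > d. As 0 < d and alpha < 2, the last two
   branches are the cases alpha = d = 1 and alpha > d = 1. *)
Definition kernel_h (r : R) : R :=
  if alpha < d%:R then r `^ (- (d%:R - alpha))
  else if alpha == d%:R then ln (1 + r^-1)
  else 1.

Definition kernel_kappa (m r : R) : R :=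
  m `^ ((d%:R + alpha) / (2 * alpha)) *
  besselK ((d%:R + alpha) / 2) (m `^ alpha^-1 * r).

(* Meant for r > 0. The integrals below also evaluate it at r = 0, but only on
   the diagonal, which is a null set. *)
Definition kernel_H (m r : R) : R :=
  if r <= 1 then kernel_h r
  else if m == 0 then
    2 `^ ((d%:R + alpha) / 2 - 1) * Gamma ((d%:R + alpha) / 2) *
    r `^ (- (d%:R + alpha))
  else r `^ (- ((d%:R + alpha) / 2)) * kernel_kappa m r.

Local Open Scope ereal_scope.

Definition rollnik_sqr (V : Rn R d -> R) : \bar R :=
  \int[lebesgue_Rn R d]_y \int[lebesgue_Rn R d]_x
    (`|V x| * `|V y| /
      euclidean_dist x y `^ (2 * (d%:R - alpha)))%R%:E.

Definition rollnik_norm (V : Rn R d -> R) : \bar R := sqrte (rollnik_sqr V).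

Definition rollnik : set (Rn R d -> R) :=
  [set V | measurable_fun setT V /\ rollnik_sqr V < +oo].

Definition ext_rollnik_sqr (m : R) (V : Rn R d -> R) : \bar R :=
  \int[lebesgue_Rn R d]_y \int[lebesgue_Rn R d]_x
    (kernel_H m (euclidean_dist x y) ^+ 2 * `|V x| * `|V y|)%R%:E.

Definition ext_rollnik_seminorm (m : R) (V : Rn R d -> R) : \bar R :=
  sqrte (ext_rollnik_sqr m V).

Definition ext_rollnik (m : R) : set (Rn R d -> R) :=
  [set V | measurable_fun setT V /\ ext_rollnik_sqr m V < +oo].

End rollnik.

Arguments rollnik {R} d alpha.
Arguments ext_rollnik {R} d alpha m.

(* Main.v *)
(* Both inclusions are pointwise kernel inequalities integrated against
   |V(x)||V(y)|; write s = (d + alpha) / 2.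

   (1) If alpha < d then H^0(r) <= C r^{-(d - alpha)} for all r, since for r > 1
   the tail r^{-(d + alpha)} is smaller than r^{-(d - alpha)}.

   (2) H^m(r) and H^0(r) agree for r <= 1. For r > 1, K_s(z) <= C z^{-s} gives
   kappa_m(r) <= C m^{s / alpha} (m^{1 / alpha} r)^{-s} = C r^{-s}, a bound in
   which m cancels. The estimate on K_s follows from
   e^{-z^2/(4t)} <= (1 + z^2/(4t(s+1)))^{-(s+1)}, which bounds the integrand by
   the derivative of an explicit function of t; the same device shows that the
   Gamma integral is finite. *)
Require Import Defs.
From mathcomp Require Import all_boot all_order all_algebra.
From mathcomp Require Import all_classical all_reals all_analysis.
From mathcomp Require Import measurable_realfun ring lra.

Set Implicit Arguments.
Unset Strict Implicit.
Unset Printing Implicit Defensive.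

Import Order.TTheory GRing.Theory Num.Theory.
Import numFieldNormedType.Exports.
Import HBNNSimple.

Local Open Scope classical_set_scope.
Local Open Scope ring_scope.

(** * Comparison of integrals and antiderivatives on the half-line *)

(* No measurability is assumed: the integral of a nonnegative function is a
   supremum over the simple functions below it. *)
Lemma ge0_le_integralZl {d : measure_display} {T : measurableType d}
    {R : realType} (mu : {measure set T -> \bar R}) (D : set T)
    (f g : T -> \bar R) (k : R) :
  0 < k -> (forall x, D x -> (0 <= f x)%E) -> (forall x, D x -> (0 <= g x)%E) ->
  (forall x, D x -> (f x <= k%:E * g x)%E) ->
  (\int[mu]_(x in D) f x <= k%:E * \int[mu]_(x in D) g x)%E.
Proof.
move=> k0 f0 g0 fg.
rewrite (ge0_integralE _ f0) (ge0_integralE _ g0).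
apply: ge_ereal_sup => _ [h /= hf <-].
have kV0 : 0 <= k^-1 by rewrite invr_ge0 ltW.
rewrite -lee_pdivrMl// -sintegralrM.
apply: ereal_sup_ubound; exists (scale_nnsfun h kV0) => //= x.
have := hf x; rewrite /patch; case: ifPn => [/[!inE] Dx|_] hx.
  by rewrite EFinM lee_pdivrMl// (le_trans hx)// fg.
by rewrite lee_fin mulr_ge0_le0.
Qed.

Lemma is_derive1_powR_shift {R : realType} (c p t : R) : 0 < t + c ->
  is_derive t 1 (fun u => (u + c) `^ p) (p * (t + c) `^ (p - 1)).
Proof.
move=> tc.
have dg : is_derive t 1 (fun u : R => u + c) 1.
  by rewrite -[X in is_derive _ _ _ X]addr0; exact: is_deriveD.
have := @is_derive1_comp R (fun u => u `^ p) (fun u => u + c) t _ _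
  (is_derive1_powR p tc) dg.
by rewrite mulr1.
Qed.

(** The fundamental theorem of calculus applies on compact intervals exhausting the half-line, and
    monotone convergence passes to the limit. Bounding the increments of [F] avoids computing its
    limits at 0 and at infinity. *)
Lemma ge0_integral_oy_le {R : realType} (f F : R -> R) (M : R) :
  (forall t : R, 0 < t -> 0 <= f t) ->
  (forall t : R, 0 < t -> derivable f t 1) ->
  (forall t : R, 0 < t -> is_derive t 1 F (f t)) ->
  (forall a b : R, 0 < a -> a < b -> F b - F a <= M) ->
  (\int[@lebesgue_measure R]_(t in `]0%R, +oo[) (f t)%:E <= M%:E)%E.
Proof.
move=> f0 df dF FM.
(* Starting at 2 keeps the two endpoints distinct even for [n = 0]. *)
pose S n : set R := `[n.+2%:R^-1, n.+2%:R]%classic.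
have S0 n t : S n t -> 0 < t.
  by rewrite /S/= in_itv/= => /andP[+ _]; apply: lt_le_trans; rewrite invr_gt0.
have SE : `]0, +oo[%classic = \bigcup_n S n.
  apply/seteqP; split=> [t|t [n _ /S0]]; last by rewrite /= in_itv/= andbT.
  rewrite /= in_itv/= andbT => t0.
  have [n nt nt'] : exists2 n, t <= n.+2%:R & t^-1 <= n.+2%:R.
    exists (maxn (Num.truncn t) (Num.truncn t^-1)).
      rewrite (le_trans (ltW (truncnS_gt _)))// ler_nat ltnS ltnW//.
      by rewrite ltnS leq_maxl.
    rewrite (le_trans (ltW (truncnS_gt _)))// ler_nat ltnS ltnW//.
    by rewrite ltnS leq_maxr.
  exists n => //; rewrite /S/= in_itv/= nt andbT.
  by rewrite -[leRHS]invrK lef_pV2// posrE ?invr_gt0.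
have ctsf n : {within S n, continuous f}.
  apply: derivable_within_continuous => t /S0; exact: df.
have le_n n : n.+2%:R^-1 < n.+2%:R :> R.
  by rewrite (@lt_trans _ _ 1)// ?invf_lt1// ltr1n.
have intS n : (\int[@lebesgue_measure R]_(t in S n) (f t)%:E <= M%:E)%E.
  rewrite (@continuous_FTC2 _ f F)//.
  - by rewrite -EFinB lee_fin FM.
  - exact: ctsf.
  - split.
    + move=> t; rewrite in_itv/= => /andP[t1 _].
      by apply: ex_derive; apply: dF; rewrite (lt_trans _ t1).
    + apply: cvg_at_right_filter; apply: differentiable_continuous.
      by apply/derivable1_diffP; apply: ex_derive; apply: dF.
    + apply: cvg_at_left_filter; apply: differentiable_continuous.
      by apply/derivable1_diffP; apply: ex_derive; apply: dF.
  - move=> t; rewrite in_itv/= => /andP[t1 _].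
    rewrite derive1E; apply: derive_val; apply: dF.
    by rewrite (lt_trans _ t1).
rewrite SE.
have cvgS := @ge0_nondecreasing_set_cvg_integral _ (measurableTypeR R) R S
  (EFin \o f) (@lebesgue_measure R).
apply: (cvge_le _ (cvgS _ _ _ _)).
- by apply: nearW.
- apply/nondecreasing_seqP => n; rewrite subsetEset => t.
  rewrite /S/= !in_itv/= => /andP[nt tn]; apply/andP; split.
    by rewrite (le_trans _ nt)// lef_pV2 ?posrE// ler_nat.
  by rewrite (le_trans tn)// ler_nat.
- by move=> n; exact: measurable_itv.
- move=> n; apply/measurable_EFinP.
  by apply: subspace_continuous_measurable_fun => //; exact: measurable_itv.
- by move=> n t /S0 t0; rewrite lee_fin f0.
Qed.

(** Raise $1 + u \le e^u$, with $u = x/p$, to the power $-p$. *)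
Lemma expRN_le_powR {R : realType} (p x : R) : 0 < p -> 0 <= x ->
  expR (- x) <= (1 + x / p) `^ (- p).
Proof.
move=> p0 x0.
have xp0 : 0 < 1 + x / p by rewrite ltr_pwDl// divr_ge0// ltW.
rewrite (_ : - x = x / p * - p); last by rewrite mulrN divfK// gt_eqF.
rewrite expRM !powRN lef_pV2 ?posrE ?powR_gt0 ?expR_gt0//.
by rewrite ge0_ler_powR ?nnegrE ?expR_ge0 ?expR_ge1Dx// ltW.
Qed.

Lemma ge0_le_integralZl_EFin {d : measure_display} {T : measurableType d}
    {R : realType} (mu : {measure set T -> \bar R}) (D : set T)
    (f g : T -> R) (k M : R) :
  0 < k -> (forall x, D x -> 0 <= f x) -> (forall x, D x -> f x <= k * g x) ->
  (\int[mu]_(x in D) (g x)%:E <= M%:E)%E ->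
  (\int[mu]_(x in D) (f x)%:E <= (k * M)%:E)%E.
Proof.
move=> k0 f0 fg gM.
have g0 x : D x -> 0 <= g x.
  by move=> Dx; rewrite -(pmulr_rge0 _ k0) (le_trans (f0 _ Dx))// fg.
rewrite (le_trans (@ge0_le_integralZl _ _ _ mu D _ (EFin \o g) _ k0 _ _ _))//.
by rewrite EFinM lee_pmul2l.
Qed.

(** * The bound on the modified Bessel function *)

(** An antiderivative is $-(t+c)^{-s}/s$, whose increment from $a$ to $b$ is at most $(a+c)^{-s}/s
    \le c^{-s}/s$. *)
Lemma integral_powR_shift_le {R : realType} (s c : R) : 0 < s -> 0 < c ->
  (\int[@lebesgue_measure R]_(t in `]0%R, +oo[) ((t + c) `^ (- s - 1))%:E
    <= (c `^ (- s) / s)%:E)%E.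
Proof.
move=> s0 c0.
apply: (@ge0_integral_oy_le _ _ (fun t => - (t + c) `^ (- s) / s)).
- by move=> t t0; exact: powR_ge0.
- move=> t t0; apply: ex_derive; apply: is_derive1_powR_shift.
  exact: addr_gt0.
- move=> t t0.
  have tc := is_derive1_powR_shift (- s) (addr_gt0 t0 c0).
  have := is_deriveZ (- s^-1) tc.
  rewrite (_ : - s^-1 *: _ = (t + c) `^ (- s - 1)); last first.
    rewrite /GRing.scale/= mulNr mulNr mulrN opprK mulrA.
    by rewrite mulVf ?mul1r// gt_eqF.
  congr is_derive; apply/funext => u /=.
  by rewrite /GRing.scale/= /GRing.scale/=; ring.
- move=> a b a0 ab; rewrite -mulrBl ler_pM2r ?invr_gt0//.
  rewrite opprK addrC lerBlDr (@le_trans _ _ (c `^ (- s)))//; last first.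
    by rewrite lerDl powR_ge0.
  rewrite !powRN lef_pV2 ?posrE ?powR_gt0 ?addr_gt0//.
  by rewrite ge0_ler_powR ?nnegrE ?lerDr ?addr_ge0// ltW.
Qed.

Lemma powRVl {R : realType} (x s : R) : 0 <= x -> x^-1 `^ s = (x `^ s)^-1.
Proof. by move=> x0; rewrite -powRN -[x^-1]powR_inv1// -powRrM mulN1r. Qed.

Lemma powR_exprn {R : realType} (x s : R) (n : nat) :
  0 <= x -> (x ^+ n) `^ s = (x `^ s) ^+ n.
Proof.
move=> x0; rewrite -(powR_mulrn n x0) -(powR_mulrn n (powR_ge0 x s)).
exact: powRAC.
Qed.

Lemma besselK_le {R : realType} (s z : R) : 0 < s -> 0 < z ->
  besselK s z <= (s + 1) `^ s / s * 2 `^ (s - 1) * z `^ (- s).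
Proof.
move=> s0 z0.
have s10 : 0 < s + 1 by rewrite addr_gt0.
(* With this [c], $t^{-s-1}(1 + z^2/(4t(s+1)))^{-(s+1)} = (t+c)^{-s-1}$. *)
pose c := z ^+ 2 / 4 / (s + 1).
have c0 : 0 < c by rewrite !divr_gt0// exprn_gt0.
have le_int : (\int[@lebesgue_measure R]_(t in `]0%R, +oo[)
    (t `^ (- s - 1) * expR (- t - z ^+ 2 / (4 * t)))%:E
    <= (1 * (c `^ (- s) / s))%:E)%E.
  apply: (ge0_le_integralZl_EFin _ _ _ (integral_powR_shift_le s0 c0)) => //.
    by move=> t _; rewrite mulr_ge0 ?powR_ge0 ?expR_ge0.
  move=> t; rewrite /= in_itv/= andbT mul1r => t0.
  have -> : (t + c) `^ (- s - 1) =
      t `^ (- s - 1) * (1 + z ^+ 2 / (4 * t) / (s + 1)) `^ (- (s + 1)).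
    rewrite opprD -powRM ?ltW//; last first.
      by rewrite addr_gt0// !divr_gt0// ?mulr_gt0// exprn_gt0.
    by congr powR; rewrite /c; field; rewrite !gt_eqF.
  rewrite ler_wpM2l ?powR_ge0//.
  rewrite (le_trans _ (expRN_le_powR s10 _))//; last first.
    by rewrite divr_ge0// ?sqr_ge0// mulr_ge0// ltW.
  (* The factor $e^{-t} \le 1$ is dropped. *)
  by rewrite ler_expR gerDr oppr_le0 ltW.
rewrite mul1r in le_int.
rewrite /besselK.
set I := Rintegral _ _ _.
have {le_int}le_I : I <= c `^ (- s) / s.
  (* [fine] sends infinite values to 0: the upper bound excludes [+oo], and for [-oo] it suffices
     that the right-hand side is nonnegative. *)
  rewrite /I/Rintegral; move: le_int; case: integral => [r|//|_] //=.
  by rewrite divr_ge0 ?powR_ge0 ?ltW.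
rewrite (@le_trans _ _ (2^-1 * (z / 2) `^ s * (c `^ (- s) / s)))//.
  by rewrite ler_wpM2l// mulr_ge0 ?powR_ge0.
have wE : (z / 2) `^ s = z `^ s / 2 `^ s.
  by rewrite powRM ?powRVl ?invr_ge0// ltW.
(* Since $c = (z/2)^2/(s+1)$, the prefactor $(z/2)^s$ cancels half of the power in $c^{-s}$ and
   leaves $(z/2)^{-s}$. *)
have -> : c `^ (- s) = ((z / 2) `^ s ^+ 2 / (s + 1) `^ s)^-1.
  have -> : c = (z / 2) ^+ 2 / (s + 1).
    by rewrite /c; congr (_ / _); field.
  rewrite powRN powRM ?invr_ge0 ?sqr_ge0 ?(ltW s10)// powRVl ?(ltW s10)//.
  by rewrite powR_exprn// divr_ge0// ltW.
have -> : 2 `^ (s - 1) = 2 `^ s / 2 :> R.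
  by rewrite powRB ?powRr1//; apply/implyP => _; rewrite pnatr_eq0.
have zs0 : z `^ s != 0 by rewrite gt_eqF// powR_gt0.
have s20 : (2 : R) `^ s != 0 by rewrite gt_eqF// powR_gt0.
have s1s0 : (s + 1) `^ s != 0 by rewrite gt_eqF// powR_gt0.
rewrite wE powRN le_eqVlt; apply/orP; left; apply/eqP.
by field; rewrite zs0 s20 s1s0 gt_eqF.
Qed.

(** * Finiteness and positivity of the Gamma integral *)

(* Needed for positivity: a divergent integral would make Gamma s equal to 0. *)
Lemma integral_Gamma_lty {R : realType} (s : R) : 0 < s ->
  (\int[@lebesgue_measure R]_(t in `]0%R, +oo[)
    (t `^ (s - 1) * expR (- t))%:E < +oo)%E.
Proof.
move=> s0.
have s10 : 0 < s + 1 by rewrite addr_gt0.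
have k0 : 0 < (s + 1) `^ (s + 1) by rewrite powR_gt0.
(* f is the derivative of (t / (t + (s + 1))) ^ s *)
pose f (t : R) := s * (s + 1) * (t `^ (s - 1) * (t + (s + 1)) `^ (- s - 1)).
have f_le : (\int[@lebesgue_measure R]_(t in `]0%R, +oo[) (f t)%:E <= 1%:E)%E.
  apply: (@ge0_integral_oy_le _ _ (fun t => t `^ s * (t + (s + 1)) `^ (- s))).
  - by move=> t t0; rewrite mulr_ge0 ?mulr_ge0 ?powR_ge0// ltW.
  - move=> t t0; apply: derivableM => //; apply: derivableM.
      by apply: derivable_powR; rewrite in_itv/= t0.
    by apply: ex_derive; apply: is_derive1_powR_shift; rewrite addr_gt0.
  - move=> t t0; have ts : 0 < t + (s + 1) by rewrite addr_gt0.
    have := is_deriveM (is_derive1_powR s t0) (is_derive1_powR_shift (- s) ts).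
    rewrite [X in is_derive _ _ _ X](_ : _ = f t)// /f /GRing.scale/=.
    have -> : t `^ s = t * t `^ (s - 1) by rewrite mulr_powRB1// ltW.
    have -> : (t + (s + 1)) `^ (- s) =
        (t + (s + 1)) * (t + (s + 1)) `^ (- s - 1).
      rewrite powRB ?(gt_eqF ts) ?implybT// powRr1 ?(ltW ts)//.
      by rewrite mulrCA divff ?mulr1// gt_eqF.
    ring.
  (* The antiderivative takes its values in $[0,1]$, so its increments are at most 1. *)
  - move=> a b a0 ab.
    have b0 := lt_trans a0 ab.
    rewrite lerBlDr (@le_trans _ _ 1)//; last first.
      by rewrite lerDl mulr_ge0 ?powR_ge0.
    rewrite powRN ler_pdivrMr ?powR_gt0 ?addr_gt0// mul1r.
    by rewrite ge0_ler_powR ?nnegrE ?lerDl ?addr_ge0 ?ltW.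
(* Chosen so that $k f(t) = t^{s-1}(1 + t/(s+1))^{-(s+1)}$, which dominates the Gamma integrand. *)
pose k := (s + 1) `^ (s + 1) / (s * (s + 1)).
apply: (@le_lt_trans _ _ (k * 1)%:E); last by rewrite ltry.
apply: (ge0_le_integralZl_EFin _ _ _ f_le).
- by rewrite divr_gt0 ?mulr_gt0.
- by move=> t _; rewrite mulr_ge0 ?powR_ge0 ?expR_ge0.
move=> t; rewrite /= in_itv/= andbT => t0.
rewrite /f /k mulrA divfK ?gt_eqF ?mulr_gt0// mulrCA ler_wpM2l ?powR_ge0//.
rewrite (le_trans (expRN_le_powR s10 (ltW t0)))//.
have -> : 1 + t / (s + 1) = (t + (s + 1)) / (s + 1).
  by field; rewrite gt_eqF.
rewrite -opprD !powRN powRM ?invr_ge0 ?addr_ge0 ?(ltW s0) ?(ltW t0)// invfM.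
by rewrite powRVl ?(ltW s10)// invrK mulrC.
Qed.

(** The integrand is bounded below by a positive constant on $[1,2]$, and finiteness ensures that
    [fine] keeps the integral positive. *)
Lemma Gamma_gt0 {R : realType} (s : R) : 0 < s -> 0 < Gamma s.
Proof.
move=> s0.
set f := fun t : R => t `^ (s - 1) * expR (- t).
have f0 t : 0 <= f t by rewrite mulr_ge0 ?powR_ge0 ?expR_ge0.
have f_lty := integral_Gamma_lty s0.
rewrite /Gamma /Rintegral fine_gt0// f_lty andbT.
rewrite integral_mkcond.
(* On $[1,2]$, $t^{s-1} \ge t^{-1} \ge 1/2$ because $s > 0$, and $e^{-t} \ge e^{-2}$. *)
pose k : R := expR (- 2) / 2.
have k0 : 0 < k by rewrite divr_gt0 ?expR_gt0.
pose g t : \bar R := (\1_(`[1%R, 2%R]%classic : set R) t)%:E.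
have : (\int[@lebesgue_measure R]_t g t <=
    (k^-1)%:E * \int[@lebesgue_measure R]_t ((EFin \o f) \_ `]0%R, +oo[) t)%E.
  apply: ge0_le_integralZl.
  - by rewrite invr_gt0.
  - by move=> t _; rewrite lee_fin.
  - by move=> t _; apply: erestrict_ge0 => u _; rewrite /= lee_fin.
  move=> t _; rewrite /g indicE; case: (boolP (t \in _)) => [|_]; last first.
    rewrite mule_ge0 ?lee_fin ?invr_ge0 ?(ltW k0)//.
    by apply: erestrict_ge0 => u _; rewrite /= lee_fin.
  rewrite inE/= in_itv/= => /andP[t1 t2].
  have t0 : 0 < t by rewrite (lt_le_trans _ t1).
  rewrite patchE mem_set/= ?in_itv/= ?andbT//.
  rewrite lee_fin ler_pdivlMl// mulr1 /k /f mulrC ler_pM ?invr_ge0 ?expR_ge0//.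
    apply: (@le_trans _ _ t^-1); first by rewrite lef_pV2 ?posrE.
    by rewrite -[t^-1]powR_inv1 ?(ltW t0)// ler_powR// lerDr ltW.
  by rewrite ler_expR lerN2.
rewrite integral_indic//= setIT lebesgue_measure_itv/= lte_fin ltr1n/=.
move=> H; rewrite lt_neqAle; apply/andP; split; last first.
  apply: integral_ge0 => t _.
  by apply: erestrict_ge0 => u _; rewrite lee_fin f0.
(* A zero integral would force the length of $[1,2]$ to be at most 0. *)
apply/eqP => I0; move: H; rewrite -I0 mule0.
by rewrite -EFinB lee_fin; apply/negP; rewrite -ltNge; lra.
Qed.

(** * Iterated integrals and pointwise kernel inequalities *)

Lemma ge0_le_iterated_integralZl {d1 d2 : measure_display}
    {T1 : measurableType d1} {T2 : measurableType d2} {R : realType}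
    (mu1 : {measure set T1 -> \bar R}) (mu2 : {measure set T2 -> \bar R})
    (f g : T1 -> T2 -> R) (k : R) :
  0 < k -> (forall x y, 0 <= f x y) -> (forall x y, f x y <= k * g x y) ->
  (\int[mu2]_y \int[mu1]_x (f x y)%:E
    <= k%:E * \int[mu2]_y \int[mu1]_x (g x y)%:E)%E.
Proof.
move=> k0 f0 fg.
have g0 x y : 0 <= g x y by rewrite -(pmulr_rge0 _ k0) (le_trans (f0 x y)).
apply: ge0_le_integralZl => // y _.
- by apply: integral_ge0 => x _; rewrite lee_fin.
- by apply: integral_ge0 => x _; rewrite lee_fin.
- by apply: ge0_le_integralZl => // x _; rewrite lee_fin.
Qed.

Lemma euclidean_dist_ge0 {R : realType} {d : nat} (x y : Rn R d) :
  0 <= euclidean_dist x y.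
Proof. exact: sqrtr_ge0. Qed.

Lemma besselK_ge0 {R : realType} (rho z : R) : 0 <= besselK rho z.
Proof.
rewrite mulr_ge0 ?mulr_ge0 ?powR_ge0// fine_ge0// integral_ge0// => t _.
by rewrite lee_fin mulr_ge0 ?powR_ge0 ?expR_ge0.
Qed.

Section kernel.
Context {R : realType} {d : nat} {alpha : R}.
Hypothesis alpha_gt0 : 0 < alpha.

Lemma kernel_exponent_gt0 : 0 < (d%:R + alpha) / 2.
Proof. by rewrite divr_gt0// ltr_wpDl. Qed.

Lemma kernel_h_ge0 (r : R) : 0 <= r -> 0 <= kernel_h d alpha r.
Proof.
move=> r0; rewrite /kernel_h; case: ifP => _; first exact: powR_ge0.
by case: ifP => // _; rewrite ln_ge0// lerDl invr_ge0.
Qed.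

Lemma kernel_H_ge0 (m r : R) : 0 <= r -> 0 <= kernel_H d alpha m r.
Proof.
move=> r0; rewrite /kernel_H; case: ifP => _; first exact: kernel_h_ge0.
case: ifP => _.
  by rewrite !mulr_ge0 ?powR_ge0// ltW// Gamma_gt0// kernel_exponent_gt0.
apply: mulr_ge0; first exact: powR_ge0.
by apply: mulr_ge0; [exact: powR_ge0|exact: besselK_ge0].
Qed.

Lemma kernel_kappa_le (m r : R) (s := (d%:R + alpha) / 2) : 0 < m -> 0 < r ->
  kernel_kappa d alpha m r <= (s + 1) `^ s / s * 2 `^ (s - 1) * r `^ (- s).
Proof.
rewrite /kernel_kappa -/s => m0 r0.
have s0 : 0 < s := kernel_exponent_gt0.
have -> : (d%:R + alpha) / (2 * alpha) = s / alpha.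
  by rewrite /s; field; rewrite gt_eqF.
move: s s0 => s s0.
have ma0 : 0 < m `^ alpha^-1 by rewrite powR_gt0.
rewrite (le_trans (ler_wpM2l (powR_ge0 _ _)
  (besselK_le s0 (mulr_gt0 ma0 r0))))//.
rewrite powRM ?(ltW ma0) ?(ltW r0)// -powRrM.
rewrite mulrN [alpha^-1 * s]mulrC !powRN.
have rs0 : r `^ s != 0 by rewrite gt_eqF// powR_gt0.
have ms0 : m `^ (s / alpha) != 0 by rewrite gt_eqF// powR_gt0.
by rewrite le_eqVlt; apply/orP; left; apply/eqP; field; rewrite ms0 rs0 gt_eqF.
Qed.

(** [C] is chosen before [m]; this uniformity makes the constant in (2) depend on [d] and [alpha]
    only. *)
Lemma kernel_H_le_kernel_H0 :
  exists2 C : R, 0 < C & forall m r : R, 0 < m ->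
    0 <= r -> kernel_H d alpha m r <= C * kernel_H d alpha 0 r.
Proof.
set s := (d%:R + alpha) / 2.
have s0 : 0 < s := kernel_exponent_gt0.
(* [A] is the ratio of the constant in [kernel_kappa_le] to that in the tail of $H^0$; the factor
   $2^{s-1}$ is common to both. *)
have [A A0 AE] : exists2 A, 0 < A & A * Gamma s = (s + 1) `^ s / s.
  have G0 := Gamma_gt0 s0.
  exists ((s + 1) `^ s / s / Gamma s); last by rewrite divfK// gt_eqF.
  by apply: divr_gt0 => //; apply: divr_gt0 => //; rewrite powR_gt0 ?addr_gt0.
(* The 1 covers $r \le 1$, where the kernels coincide, and [A] covers the tail. *)
exists (Num.max 1 A) => [|m r m0 r0]; first by rewrite lt_max A0 orbT.
have := kernel_H_ge0 0 r0; have := kernel_kappa_le (r := r) m0.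
rewrite /kernel_H -/s eqxx (gt_eqF m0); case: ifPn => [_ _ h0|].
  by rewrite ler_peMl// le_max lexx.
rewrite -ltNge => r1 /(_ (lt_trans ltr01 r1)) le_kappa H0.
have {}r0 : 0 < r := lt_trans ltr01 r1.
apply: (@le_trans _ _ (A * (2 `^ (s - 1) * Gamma s * r `^ (- (d%:R + alpha))))).
  rewrite (le_trans (ler_wpM2l (powR_ge0 _ _) le_kappa))//.
  (* One factor $r^{-s}$ comes from the definition of $H^m$, the other from the bound on
     [kernel_kappa]. *)
  have -> : - (d%:R + alpha) = - s + - s by rewrite /s; field.
  rewrite (@powRD _ r); last by rewrite (gt_eqF r0) implybT.
  rewrite -AE le_eqVlt; apply/orP; left; apply/eqP.
  by move: (Gamma s) => G; ring.
by rewrite ler_wpM2r// le_max lexx orbT.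
Qed.

(** The power on the right is the square root of the kernel in [rollnik_sqr]. *)
Lemma kernel_H0_le_riesz : alpha < d%:R ->
  exists2 C : R, 0 < C & forall r : R,
    0 <= r -> kernel_H d alpha 0 r <= C * r `^ (- (d%:R - alpha)).
Proof.
move=> ad; rewrite /kernel_H.
set A := 2 `^ _ * Gamma _.
have A0 : 0 < A.
  by apply: mulr_gt0; [rewrite powR_gt0|exact/Gamma_gt0/kernel_exponent_gt0].
move: A A0 => A A0.
exists (Num.max 1 A) => [|r r0]; first by rewrite lt_max A0 orbT.
case: ifPn => [_|].
  by rewrite /kernel_h ad ler_peMl ?powR_ge0// le_max lexx.
rewrite -ltNge => r1; rewrite eqxx.
rewrite ler_pM ?powR_ge0 ?(ltW A0) ?le_max ?lexx ?orbT// ler_powR ?(ltW r1)//.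
by move: alpha_gt0; lra.
Qed.

End kernel.

(** * From kernel inequalities to seminorms *)

(* This includes r = 0, where both sides are 0 if a != 0 and 1 otherwise; hence
   the diagonal x = y needs no separate treatment. *)
Lemma sqr_powRN {R : realType} (a r : R) :
  (r `^ (- a)) ^+ 2 = (r `^ (2 * a))^-1.
Proof. by rewrite -powR_mulrn ?powR_ge0// -powRrM -powRN mulNr mulrC. Qed.

(** Serves both inclusions: [h] is $r^{-(d-\alpha)}$ in (1) and $H^0$ in (2). Nonnegativity of the
    kernel allows squaring the bound. *)
Lemma ext_rollnik_sqr_le {R : realType} (d : nat) (alpha m C : R)
    (h : R -> R) (V : Rn R d -> R) :
  0 < alpha -> 0 < C ->
  (forall r : R, 0 <= r -> kernel_H d alpha m r <= C * h r) ->
  (ext_rollnik_sqr alpha m V <= (C ^+ 2)%:E *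
    \int[lebesgue_Rn R d]_y \int[lebesgue_Rn R d]_x
      (h (euclidean_dist x y) ^+ 2 * `|V x| * `|V y|)%R%:E)%E.
Proof.
move=> alpha0 C0 hC; apply: ge0_le_iterated_integralZl => [|x y|x y].
- by rewrite exprn_gt0.
- by apply: mulr_ge0 => //; apply: mulr_ge0 => //; exact: sqr_ge0.
have xy0 := euclidean_dist_ge0 x y.
have H0 := kernel_H_ge0 (d := d) alpha0 m xy0.
rewrite [leRHS]mulrA ler_wpM2r// [leRHS]mulrA ler_wpM2r//.
rewrite -exprMn ler_sqr ?nnegrE ?hC//.
by rewrite (le_trans H0)// hC.
Qed.

Lemma sqrte_leZ {R : realType} (C : R) (a b : \bar R) :
  0 <= C -> (0 <= b)%E -> (a <= (C ^+ 2)%:E * b)%E ->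
  (sqrte a <= C%:E * sqrte b)%E.
Proof.
move=> C0 b0 ab; rewrite -[leRHS](_ : sqrte ((C ^+ 2)%:E * b) = _).
  by rewrite lee_sqrt// mule_ge0// lee_fin sqr_ge0.
by rewrite sqrteM ?lee_fin ?sqr_ge0//= sqrtr_sqr ger0_norm.
Qed.

Theorem proposition3p27 (R : realType) (alpha : R) (d : nat)
    (alpha_gt0 : 0 < alpha) (alpha_lt2 : alpha < 2)
    (d_gt0 : (0 < d)%N) (d_lt2alpha : d%:R < 2 * alpha) :
  (alpha < d%:R ->
    rollnik d alpha `<=` ext_rollnik d alpha 0 /\
    exists C : R, 0 < C /\
      forall V : Rn R d -> R, rollnik d alpha V ->
        (ext_rollnik_seminorm alpha 0 V <= C%:E * rollnik_norm alpha V)%E) /\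
  ((forall m : R, 0 < m -> ext_rollnik d alpha 0 `<=` ext_rollnik d alpha m) /\
    exists C : R, 0 < C /\
      forall m : R, 0 < m ->
      forall V : Rn R d -> R, ext_rollnik d alpha 0 V ->
        (ext_rollnik_seminorm alpha m V
           <= C%:E * ext_rollnik_seminorm alpha 0 V)%E).
Proof.
split=> [alpha_lt_d|].
  have [C C0 HC] := kernel_H0_le_riesz alpha_gt0 alpha_lt_d.
  (* This inequality between squares gives both claims: finiteness yields the inclusion, and square
     roots yield the estimate. *)
  have le_sqr (V : Rn R d -> R) :
      (ext_rollnik_sqr alpha 0 V <= (C ^+ 2)%:E * rollnik_sqr alpha V)%E.
    apply: le_trans (ext_rollnik_sqr_le V alpha_gt0 C0 HC) _.
    rewrite /rollnik_sqr le_eqVlt; apply/orP; left; apply/eqP.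
    congr (_ * _)%E; apply: eq_integral => y _; apply: eq_integral => x _.
    by rewrite sqr_powRN -mulrA mulrC.
  split=> [V [mV V_lty]|].
    split; first exact: mV.
    apply: le_lt_trans (le_sqr V) _.
    by rewrite lte_mul_pinfty// ?lee_fin ?sqr_ge0.
  exists C; split; first exact: C0.
  move=> V _; apply: sqrte_leZ => //; first exact: ltW.
  apply: integral_ge0 => y _; apply: integral_ge0 => x _.
  by rewrite lee_fin divr_ge0 ?mulr_ge0 ?powR_ge0.
have [C C0 HC] := kernel_H_le_kernel_H0 (d := d) alpha_gt0.
(* The same [C] serves every [m], as it was obtained before [m] was introduced. *)
have le_sqr (m : R) (V : Rn R d -> R) : 0 < m ->
    (ext_rollnik_sqr alpha m V <= (C ^+ 2)%:E * ext_rollnik_sqr alpha 0 V)%E.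
  by move=> m0; apply: ext_rollnik_sqr_le => // r; exact: HC.
split=> [m m0 V [mV V_lty]|].
  split; first exact: mV.
  apply: le_lt_trans (le_sqr m V m0) _.
  by rewrite lte_mul_pinfty// ?lee_fin ?sqr_ge0.
exists C; split; first exact: C0.
move=> m m0 V _; apply: sqrte_leZ.
- exact: ltW.
- apply: integral_ge0 => y _; apply: integral_ge0 => x _.
  by rewrite lee_fin; do 2 apply: mulr_ge0 => //; exact: sqr_ge0.
- exact: le_sqr.
Qed.
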